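(* There is a universally obviously strategy-proof randomized mechanism for unknown single-minded bidders in a multi-unit auction that gives a $400$-approximation to the optimal social welfare.
   Context: A multi-unit auction has $m$ identical items; bidder $i$'s valuation is $v_i:\{0,1,\dots,m\}\to\mathbb{R}_{\ge0}$ (value for a number of items). A valuation is single-minded if there are $x_i\ge0$ and $d_i\in\{1,\dots,m\}$ with $v_i(q)=x_i$ for $q\ge d_i$ and $v_i(q)=0$ otherwise; ''unknown single-minded'' means both $x_i$ and $d_i$ are private (the domain is all single-minded valuations). Utilities are quasi-linear. A deterministic mechanism is a rooted tree: each internal node is assigned to one bidder, who sends one of the messages labeling the outgoing edges; each leaf is labeled with a feasible allocation (quantities summing to at most $m$) and payments. A behavior $B_i$ specifies a message at every node of bidder $i$; a profile $B$ determines a root-to-leaf path $\mathrm{Path}(B)$ with allocation $f_i(B)$ and payment $p_i(B)$ for $i$. A strategy $\mathcal S_i$ maps each valuation in the domain to a behavior; it is obviously dominant if for every $v_i$, every node $u$ of $i$, every $B_{-i}$ and every profile $B'$ with $u\in\mathrm{Path}(\mathcal S_i(v_i),B_{-i})\cap\mathrm{Path}(B')$ and $B'_i$ sending at $u$ a message different from $\mathcal S_i(v_i)$'s, $v_i(f_i(\mathcal S_i(v_i),B_{-i}))-p_i(\mathcal S_i(v_i),B_{-i})\ge v_i(f_i(B'))-p_i(B')$. A randomized mechanism (a distribution over deterministic mechanisms with strategies) is universally OSP if each mechanism in its support is OSP; it gives an $\alpha$-approximation if for every profile $\mathrm{OPT}\le\alpha\,\mathbb{E}[\text{welfare}]$ when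 bidders follow their strategies, $\mathrm{OPT}$ being the maximum of $\sum_iv_i(q_i)$ over $q_i\ge0$ integers with $\sum_iq_i\le m$. *)

(* Defs.v *)
From mathcomp Require Import all_boot all_order all_algebra.
From mathcomp Require Import reals.
From Stdlib Require List.
Unset Strict Implicit. Unset Printing Implicit Defensive.
Import Order.TTheory GRing.Theory Num.Theory.
Local Open Scope ring_scope.

Section Auction.
Variables (R : realType) (n m : nat).

Definition singleminded (v : nat -> R) : Prop :=
  exists (x : R) (d : nat),
    0 <= x /\ (1 <= d)%N /\ (d <= m)%N /\
    forall q : nat, v q = (if (d <= q)%N then x else 0).

(* Deterministic mechanism: a rooted tree with finite root-to-leaf paths.
   Each internal node belongs to a bidder and has an arbitrary message type;
   each leaf carries an allocation (quantities) and payments. *)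
Inductive mech : Type :=
| Leaf : ('I_n -> nat) -> ('I_n -> R) -> mech
| Node : 'I_n -> forall M : Type, (M -> mech) -> mech.

Fixpoint node (t : mech) : Type :=
  match t with
  | Leaf _ _ => Empty_set
  | Node _ M k => (unit + {x : M & node (k x)})%type
  end.

Fixpoint owner (t : mech) : node t -> 'I_n :=
  match t return node t -> 'I_n with
  | Leaf _ _ => fun u => match u with end
  | Node i M k => fun u =>
      match u with
      | inl _ => i
      | inr (existT x u') => owner (k x) u'
      end
  end.

Fixpoint msg (t : mech) : node t -> Type :=
  match t return node t -> Type with
  | Leaf _ _ => fun u => match u with end
  | Node i M k => fun u =>
      match u with
      | inl _ => M
      | inr (existT x u') => msg (k x) u'
      end
  end.

Definition behavior (t : mech) (i : 'I_n) : Type :=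
  forall u : node t, owner t u = i -> msg t u.

(* A profile of behaviors: since each node has exactly one owner, a profile
   (B_1,...,B_n) is the same as a choice of a message at every node. *)
Definition profile (t : mech) : Type := forall u : node t, msg t u.

Definition mix (t : mech) (i : 'I_n) (b : behavior t i) (B : profile t)
  : profile t :=
  fun u => match @eqP _ (owner t u) i with
           | ReflectT h => b u h
           | ReflectF _ => B u
           end.

Fixpoint outcome (t : mech) : profile t -> ('I_n -> nat) * ('I_n -> R) :=
  match t return profile t -> ('I_n -> nat) * ('I_n -> R) with
  | Leaf f p => fun _ => (f, p)
  | Node i M k => fun B =>
      outcome (k (B (inl tt))) (fun u' => B (inr (existT _ (B (inl tt)) u')))
  end.

Fixpoint onPath (t : mech) : profile t -> node t -> Prop :=
  match t return profile t -> node t -> Prop with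
  | Leaf _ _ => fun _ u => match u with end
  | Node i M k => fun B u =>
      match u with
      | inl _ => True
      | inr (existT x u') =>
          B (inl tt) = x /\ onPath (k x) (fun u'' => B (inr (existT _ x u''))) u'
      end
  end.

Fixpoint feasible (t : mech) : Prop :=
  match t with
  | Leaf f _ => (\sum_(i < n) f i <= m)%N
  | Node _ M k => forall x : M, feasible (k x)
  end.

Definition utility (t : mech) (v : nat -> R) (i : 'I_n) (B : profile t) : R :=
  v ((outcome t B).1 i) - (outcome t B).2 i.

Record mech_strat : Type := MechStrat {
  ms_tree : mech;
  ms_strat : forall i : 'I_n, (nat -> R) -> behavior ms_tree i
}.

Definition obviously_dominant (t : mech) (i : 'I_n)
  (S : (nat -> R) -> behavior t i) : Prop :=
  forall (v : nat -> R), singleminded v ->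
  forall (u : node t) (hu : owner t u = i) (B B' : profile t),
    onPath t (mix t i (S v) B) u -> onPath t B' u ->
    B' u <> S v u hu ->
    utility t v i B' <= utility t v i (mix t i (S v) B).

Definition OSP (M : mech_strat) : Prop :=
  forall i : 'I_n, obviously_dominant (ms_tree M) i (ms_strat M i).

Definition truthful_profile (M : mech_strat) (vs : 'I_n -> nat -> R)
  : profile (ms_tree M) :=
  fun u => ms_strat M (owner (ms_tree M) u) (vs (owner (ms_tree M) u)) u erefl.

Definition welfare (M : mech_strat) (vs : 'I_n -> nat -> R) : R :=
  \sum_(i < n) vs i ((outcome (ms_tree M) (truthful_profile M vs)).1 i).

(* Optimal social welfare over feasible allocations (q_i <= m w.l.o.g.). *)
Definition OPT (vs : 'I_n -> nat -> R) : R :=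
  \big[Num.max/0]_(q : {ffun 'I_n -> 'I_m.+1} | (\sum_(i < n) (q i : nat) <= m)%N)
     \sum_(i < n) vs i (q i : nat).

Definition distribution (D : seq (R * mech_strat)) : Prop :=
  (forall e, List.In e D -> 0 <= e.1) /\ \sum_(e <- D) e.1 = 1.

Definition universally_OSP (D : seq (R * mech_strat)) : Prop :=
  forall e, List.In e D -> 0 < e.1 -> feasible (ms_tree e.2) /\ OSP e.2.

Definition exp_welfare (D : seq (R * mech_strat)) (vs : 'I_n -> nat -> R) : R :=
  \sum_(e <- D) e.1 * welfare e.2 vs.

Definition approx (alpha : R) (D : seq (R * mech_strat)) : Prop :=
  forall vs : 'I_n -> nat -> R, (forall i, singleminded (vs i)) ->
    OPT vs <= alpha * exp_welfare D vs.

End Auction.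


Arguments singleminded {R} m v.
Arguments OSP {R n} m M.
Arguments feasible {R n} m t.
Arguments distribution {R n} D.
Arguments universally_OSP {R n} m D.
Arguments approx {R n} m alpha D.
Arguments OPT {R n} m vs.
Arguments welfare {R n} M vs.
Arguments exp_welfare {R n} D vs.

(* Main.v *)
(** Draw a uniformly random set S of bidders. The bidders of S report their
    valuations and receive nothing; the other bidders are then approached one
    after the other and each buys a quantity maximizing his utility among the
    items left, at prices computed from the reports. A polled bidder's outcome
    is constant, and a buyer's outcome is settled by the only message he sends,
    so the mechanism is OSP.

    Three pricing rules are mixed. If every bidder's value is at most OPT/16,
    a price of OPT(S)/(8m) per item works: let D be the difference between the
    contributions of S and of its complement to a fixed optimum. The welfare is
    at least OPT/64 - D^2/(16 OPT), trivially so when D^2 > OPT^2/4, and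
    E[D^2] is the sum of the squared contributions, at most OPT^2/16.
    Otherwise some bidder a has value above OPT/16, and with probability 1/4
    he is outside S while the runner-up b is in S. A flat fee equal to the
    maximal report then sells to a alone if v_a > v_b, and half that fee finds
    a buyer of value more than v_a / 2 if v_a = v_b. *)
Require Import Defs.
From mathcomp Require Import all_boot all_order all_algebra.
From mathcomp Require Import reals.
From mathcomp Require Import ring lra zify.
Import Order.TTheory GRing.Theory Num.Theory.
Local Open Scope ring_scope.

(** * Mechanisms built together with their strategies: polling, then sequential sale *)

Section Trees.
Variables (R : realType) (n : nat).
Implicit Types (i j : 'I_n) (v : nat -> R) (vs : 'I_n -> nat -> R).

Definition stop (f : 'I_n -> nat) (p : 'I_n -> R) : mech_strat R n :=
  MechStrat R n (Leaf R n f p) (fun i v u => match u with end).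

Definition ask i (M : Type) (c : (nat -> R) -> M) (K : M -> mech_strat R n) :
    mech_strat R n :=
  MechStrat R n (Node R n i M (fun x => ms_tree R n (K x)))
    (fun j v u =>
       match u return
         owner R n (Node R n i M (fun x => ms_tree R n (K x))) u = j ->
         msg R n (Node R n i M (fun x => ms_tree R n (K x))) u with
       | inl _ => fun _ => c v
       | inr (existT x u') => ms_strat R n (K x) j v u'
       end).

Lemma mixE (t : mech R n) i b B u (h : owner R n t u = i) :
  mix R n t i b B u = b u h.
Proof.
rewrite /mix; case: eqP => [h'|/(_ h) //].
by rewrite (eq_irrelevance h' h).
Qed.

Lemma utility_node i j (M : Type) (k : M -> mech R n) v
    (B : profile R n (Node R n i M k)) (x : M) : B (inl tt) = x ->
  utility R n (Node R n i M k) v j B =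
  utility R n (k x) v j (fun u => B (inr (existT _ x u))).
Proof. by move=> <-. Qed.

(** Obvious dominance compares any continuation after [c v] with any continuation after another
    message, so [B] and [B'] are unrelated in the second hypothesis. Its case [x = c v] makes the
    utility of [i] constant after the truthful message. *)
Lemma OSP_ask m i (M : Type) c (K : M -> mech_strat R n) :
    (forall x, OSP m (K x)) ->
    (forall v x B B',
       utility R n (ms_tree R n (K x)) v i B' <=
       utility R n (ms_tree R n (K (c v))) v i B) ->
  OSP m (ask i M c K).
Proof.
move=> ospK best j v v_sm [[]|[x u]] /= hu B B'.
- move=> _ _ _; subst j.
  rewrite (utility_node _ _ _ _ _ B' _ erefl).
  rewrite (utility_node _ _ _ _ _ (mix _ _ _ _ _ _) (c v)) ?best //.
  by rewrite (mixE (Node R n i M _) i _ _ (inl tt) erefl).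
- move=> [Bx onB] [B'x onB'] dev.
  rewrite (utility_node _ _ _ _ _ _ _ Bx) (utility_node _ _ _ _ _ _ _ B'x).
  exact: (ospK x j v v_sm u hu (fun u => B (inr (existT _ x u)))).
Qed.

(* Ties are broken in favour of buying nothing; [welfare_flat] relies on this
   to get a strict inequality. *)
Definition choice (pi v : nat -> R) (k : nat) : 'I_k.+1 :=
  let q := [arg max_(q > ord0 : 'I_k.+1) (v q - pi q)]%O in
  if v 0%N - pi 0%N < v q - pi q then q else ord0.

Lemma choice_max pi v k q : (q <= k)%N ->
  v q - pi q <= v (choice pi v k) - pi (choice pi v k).
Proof.
rewrite -ltnS => qk; rewrite /choice; case: arg_maxP => //= c _ cmax.
by have := cmax (Ordinal qk) isT; case: ltP => //= c0 /le_trans; apply.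
Qed.

Lemma choice_gt pi v k : (0 < choice pi v k)%N ->
  v 0%N - pi 0%N < v (choice pi v k) - pi (choice pi v k).
Proof. by rewrite /choice; case: ifP. Qed.

(** [f] accumulates the sales. Payments are read off [f] at the leaf, so a bidder who is never
    approached also pays [pi (f i)]; hence the later requirement that prices vanish at 0. *)
Fixpoint sell (pi : nat -> R) (s : seq 'I_n) (k : nat) (f : 'I_n -> nat) :
    mech_strat R n :=
  if s is i :: s' then
    ask i 'I_k.+1 (fun v => choice pi v k)
      (fun q => sell pi s' (k - q) [eta f with i |-> (q : nat)])
  else stop f (fun i => pi (f i)).

Lemma utility_sell pi s k f i v B : i \notin s ->
  utility R n (ms_tree R n (sell pi s k f)) v i B = v (f i) - pi (f i).
Proof.
elim: s k f B => //= j s IHs k f B; rewrite inE negb_or => /andP[ij is'].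
by rewrite (utility_node _ _ _ _ _ B _ erefl) IHs //= (negbTE ij).
Qed.

Lemma OSP_sell m pi s k f : uniq s -> OSP m (sell pi s k f).
Proof.
elim: s k f => [|i s IHs] k f /=; first by move=> _ ? ? ? [].
move=> /andP[i_s s_uniq]; apply: OSP_ask => [q|v q B B']; first exact: IHs.
by rewrite !utility_sell //= eqxx choice_max // -ltnS.
Qed.

Lemma sum_update (f : 'I_n -> nat) i q : f i = 0%N ->
  (\sum_j [eta f with i |-> q] j = q + \sum_j f j)%N.
Proof.
move=> fi; rewrite (bigD1 i) //= eqxx [in RHS](bigD1 i) //= fi add0n.
by congr addn; apply: eq_bigr => j /negbTE ->.
Qed.

Lemma feasible_sell m pi s k f : uniq s -> {in s, forall i, f i = 0%N} ->
  (k + \sum_i f i <= m)%N -> feasible m (ms_tree R n (sell pi s k f)).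
Proof.
elim: s k f => [|i s IHs] k f /=.
  by move=> _ _; apply: leq_trans; rewrite leq_addl.
move=> /andP[i_s s_uniq] f0 kf q; apply: IHs => //= [j js|].
  case: eqP => [ji|_]; last by rewrite f0 // inE js orbT.
  by rewrite -ji js in i_s.
rewrite sum_update ?f0 ?mem_head //.
by rewrite addnA subnK // -ltnS.
Qed.

Fixpoint poll (rule : ('I_n -> nat -> R) -> nat -> R) (s s' : seq 'I_n)
    (k : nat) (r : 'I_n -> nat -> R) : mech_strat R n :=
  if s is i :: s1 then
    ask i (nat -> R) id (fun v => poll rule s1 s' k [eta r with i |-> v])
  else sell (rule r) s' k (fun=> 0%N).

Lemma utility_poll rule s s' k r i v B : (forall r', rule r' 0%N = 0) ->
  i \notin s' -> utility R n (ms_tree R n (poll rule s s' k r)) v i B = v 0%N.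
Proof.
move=> rule0 is'; elim: s r B => [|j s IHs] r B /=.
  by rewrite utility_sell // rule0 subr0.
by rewrite (utility_node _ _ _ _ _ B _ erefl) IHs.
Qed.

Lemma OSP_poll m rule s s' k r : (forall r', rule r' 0%N = 0) -> uniq s' ->
  {in s, forall i, i \notin s'} -> OSP m (poll rule s s' k r).
Proof.
move=> rule0 s'_uniq; elim: s r => [|i s IHs] r ss' /=; first exact: OSP_sell.
apply: OSP_ask => [v|v x B B'].
  by apply: IHs => j js; rewrite ss' // inE js orbT.
by rewrite !utility_poll // ss' // mem_head.
Qed.

Lemma feasible_poll m rule s s' r : uniq s' ->
  feasible m (ms_tree R n (poll rule s s' m r)).
Proof.
move=> s'_uniq; elim: s r => [|i s IHs] r /=; last by move=> v; apply: IHs.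
by apply: feasible_sell => //; rewrite big1 ?addn0.
Qed.

Definition truthful_alloc (M : mech_strat R n) vs : 'I_n -> nat :=
  (outcome R n (ms_tree R n M) (truthful_profile R n M vs)).1.

Lemma truthful_alloc_ask i M c K vs :
  truthful_alloc (ask i M c K) vs = truthful_alloc (K (c (vs i))) vs.
Proof. by []. Qed.

(** The accumulated reports are pinned down only pointwise, which avoids functional extensionality;
    hence the existential. *)
Lemma truthful_alloc_poll rule s s' k r vs :
  exists2 r', truthful_alloc (poll rule s s' k r) vs =
              truthful_alloc (sell (rule r') s' k (fun=> 0%N)) vs
    & forall i, r' i = if i \in s then vs i else r i.
Proof.
elim: s r => [|i s IHs] r; first by exists r.
have [r' eq_r r'E] := IHs [eta r with i |-> vs i].
exists r' => [//|j]; rewrite r'E /= inE.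
by case: eqP => [->|]; case: ifP.
Qed.

(** Purchases are never revoked, so what the others buy before [i] is approached is at most their
    final total. This bounds from below the supply [k'] offered to [i]. *)
Lemma truthful_alloc_sell pi s k f vs i : uniq s ->
    {in s, forall j, f j = 0%N} ->
  let F := truthful_alloc (sell pi s k f) vs in
  [/\ forall j, (f j <= F j)%N,
      i \notin s -> F i = f i
    & i \in s -> exists2 k', F i = choice pi (vs i) k'
        & (k + \sum_j f j <= k' + \sum_(j | j != i) F j)%N].
Proof.
elim: s k f => [|a s IHs] k f; first by [].
move=> /= /andP[a_s s_uniq] f0; rewrite truthful_alloc_ask.
set q := choice pi (vs a) k.
have fa : f a = 0%N by rewrite f0 ?mem_head.
have f'0 : {in s, forall j, [eta f with a |-> (q : nat)] j = 0%N}.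
  move=> j js /=; case: eqP => [ja|_]; last by rewrite f0 // inE js orbT.
  by rewrite -ja js in a_s.
have [le_f out_s in_s] := IHs (k - q)%N _ s_uniq f'0.
have ff' j : (f j <= [eta f with a |-> (q : nat)] j)%N.
  by rewrite /=; case: eqP => // ->; rewrite fa.
split=> [j|i_as|i_as].
- exact: leq_trans (ff' j) (le_f j).
- move: i_as; rewrite inE negb_or => /andP[/negbTE ia /out_s ->] /=.
  by rewrite ia.
move: i_as; rewrite inE; case: eqP => [ia _|_ /= /in_s[k' Fi lek']].
  exists k; first by rewrite out_s ia //= eqxx.
  rewrite leq_add2l (bigD1 i) //= {1}ia fa add0n.
  by apply: leq_sum => j _; apply: leq_trans (ff' j) (le_f j).
exists k' => //; apply: leq_trans lek'; rewrite sum_update // addnA.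
by rewrite subnK // -ltnS.
Qed.

End Trees.

(** * Moments of the signs of a uniformly random subset *)

Section RandomSubset.
Variables (R : realFieldType) (T : finType).

(** Rademacher signs. The sums over all [S] below are expectations multiplied by [2 ^+ #|T|]. *)
Definition sgn (S : {set T}) (i : T) : R := if i \in S then 1 else -1.

Definition toggle (i : T) (S : {set T}) : {set T} :=
  [set x | (x \in S) (+) (x == i)].

Lemma toggleK i : involutive (toggle i).
Proof. by move=> S; apply/setP => x; rewrite !inE addbK. Qed.

Lemma sgn_toggle i S j : sgn (toggle i S) j = (-1) ^+ (j == i) * sgn S j.
Proof.
by rewrite /sgn inE; case: (j == i); case: (j \in S);
  rewrite /= ?mul1r ?expr1 ?mulN1r ?opprK.
Qed.

Lemma sum_const_sets (c : R) : \sum_(S : {set T}) c = 2 ^+ #|T| * c.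
Proof.
have cardE : #|{: {set T}}| = (2 ^ #|T|)%N.
  by rewrite -(cardsT T) -card_powerset powersetT cardsT.
by rewrite sumr_const -[LHS]mulr_natl cardE natrX.
Qed.

(** Reindexing by the involution [toggle i] shows that the sum is its own opposite. *)
Lemma sum_toggle_odd i (F : {set T} -> R) :
  (forall S, F (toggle i S) = - F S) -> \sum_S F S = 0.
Proof.
move=> Fodd; have : \sum_S F S = - \sum_S F S.
  rewrite -sumrN [LHS](reindex_inj (inv_inj (toggleK i))).
  by apply: eq_bigr.
lra.
Qed.

Lemma sum_sgn i : \sum_S sgn S i = 0.
Proof.
by apply: (sum_toggle_odd i) => S; rewrite sgn_toggle eqxx mulN1r.
Qed.

Lemma sum_sgn2 i j : \sum_S sgn S i * sgn S j = (i == j)%:R * 2 ^+ #|T|.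
Proof.
case: eqVneq => [->|ij]; last first.
  rewrite mul0r; apply: (sum_toggle_odd i) => S.
  by rewrite !sgn_toggle eqxx eq_sym (negbTE ij) mul1r mulN1r mulNr.
rewrite mul1r (eq_bigr (fun=> 1)) => [|S _]; last first.
  by rewrite /sgn; case: ifP; rewrite ?mulrNN mulr1.
by rewrite sum_const_sets mulr1.
Qed.

(** Distinct signs are uncorrelated, so only the diagonal of the expanded square survives. *)
Lemma sum_sqr_sgn (y : T -> R) :
  \sum_S (\sum_i y i * sgn S i) ^+ 2 = 2 ^+ #|T| * \sum_i y i ^+ 2.
Proof.
under eq_bigr => S _ do rewrite expr2 big_distrlr.
rewrite exchange_big mulr_sumr; apply: eq_bigr => i _.
rewrite exchange_big (bigD1 i) //= [X in _ + X]big1 ?addr0 => [|j ji].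
  under eq_bigr => S _ do rewrite mulrACA.
  by rewrite -mulr_sumr sum_sgn2 eqxx mul1r mulrC.
under eq_bigr => S _ do rewrite mulrACA.
by rewrite -mulr_sumr sum_sgn2 eq_sym (negbTE ji) mul0r mulr0.
Qed.

Lemma sum_set1_ge (F : {set T} -> R) (a : T) (c : R) :
    (forall S, 0 <= F S) -> (forall S : {set T}, a \notin S -> c <= F S) ->
  2 ^+ #|T| * (c / 2) <= \sum_S F S.
Proof.
move=> F0 Fc.
have -> : 2 ^+ #|T| * (c / 2) = \sum_S (c / 2 * (1 - sgn S a)).
  by rewrite -mulr_sumr sumrB sum_sgn sum_const_sets mulr1 subr0 mulrC.
apply: ler_sum => S _; have := F0 S; have := Fc S.
by rewrite /sgn; case: (a \in S) => [_|/(_ isT)]; lra.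
Qed.

(** The indicator of [a \notin S] and [b \in S] is [(1 - sgn S a) * (1 + sgn S b) / 4], whose
    non-constant monomials sum to zero over [S]. *)
Lemma sum_set2_ge (F : {set T} -> R) (a b : T) (c : R) : a != b ->
    (forall S, 0 <= F S) ->
    (forall S : {set T}, a \notin S -> b \in S -> c <= F S) ->
  2 ^+ #|T| * (c / 4) <= \sum_S F S.
Proof.
move=> ab F0 Fc.
have -> : 2 ^+ #|T| * (c / 4) =
    \sum_S (c / 4 * (1 - sgn S a + sgn S b - sgn S a * sgn S b)).
  rewrite -mulr_sumr sumrB big_split /= sumrB !sum_sgn sum_sgn2.
  by rewrite sum_const_sets (negbTE ab) mul0r mulr1 addr0 !subr0 mulrC.
apply: ler_sum => S _; have := F0 S; have := Fc S; rewrite /sgn.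
case: (a \in S) => [_|]; first by case: (b \in S); lra.
by case: (b \in S) => [/(_ isT isT)|_]; lra.
Qed.

End RandomSubset.

(** * The auction for a fixed sample [S] *)

Section Auction.
Variables (R : realType) (n m : nat).
Implicit Types (v : nat -> R) (vs r : 'I_n -> nat -> R) (S : {set 'I_n}).

Lemma singleminded0 v : singleminded m v -> v 0%N = 0.
Proof. by move=> [x [d [_ [d0 [_ ->]]]]]; rewrite leqNgt d0. Qed.

Lemma singleminded_ge0 v q : singleminded m v -> 0 <= v q.
Proof. by move=> [x [d [x0 [_ [_ ->]]]]]; case: ifP. Qed.

Lemma singleminded_le v q : singleminded m v -> v q <= v m.
Proof. by move=> [x [d [x0 [_ [dm E]]]]]; rewrite !E dm; case: ifP. Qed.

Lemma singleminded_pos v q : singleminded m v -> 0 < v q -> v q = v m.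
Proof.
move=> [x [d [x0 [_ [dm E]]]]]; rewrite !E dm.
by case: ifP => //; rewrite ltxx.
Qed.

Lemma singleminded_supply_gt0 v : singleminded m v -> (0 < m)%N.
Proof. by move=> [x [d [_ [d0 [dm _]]]]]; apply: leq_trans d0 dm. Qed.

(** Unpolled bidders keep the zero valuation as report, so a rule applied to the reports sees the
    optimum and the maximum over [S] only. *)
Definition auction (rule : ('I_n -> nat -> R) -> nat -> R) S :
    mech_strat R n :=
  poll R n rule (enum S) (enum (~: S)) m (fun _ _ => 0).

Lemma OSP_auction rule S : (forall r, rule r 0%N = 0) -> OSP m (auction rule S).
Proof.
move=> rule0; apply: OSP_poll => //; first exact: enum_uniq.
by move=> i; rewrite !mem_enum inE negbK.
Qed.

Lemma feasible_auction rule S : feasible m (ms_tree R n (auction rule S)).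
Proof. by apply: feasible_poll; apply: enum_uniq. Qed.

Lemma auction_alloc rule S vs :
  exists2 r, forall i, r i = if i \in S then vs i else fun=> 0 &
    forall i,
      let F := truthful_alloc R n (auction rule S) vs in
      [/\ i \in S -> F i = 0%N
        & i \notin S -> exists2 k, F i = choice R (rule r) (vs i) k
            & (m <= k + \sum_(j | j != i) F j)%N].
Proof.
have [r Fr rE] := truthful_alloc_poll R n rule (enum S) (enum (~: S)) m
  (fun _ _ => 0) vs.
exists r => i; first by rewrite rE mem_enum.
have [|j _|_ out_s in_s] := truthful_alloc_sell R n (rule r) (enum (~: S)) m
  (fun=> 0%N) vs i => //; first exact: enum_uniq.
move=> F; split=> iS; first by rewrite /F /auction Fr out_s ?mem_enum ?inE ?iS.
have [|k Fk mk] := in_s; first by rewrite mem_enum inE.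
exists k; rewrite /F /auction Fr //.
by apply: leq_trans mk; rewrite leq_addr.
Qed.

Lemma welfare_ge0 M vs : (forall i, singleminded m (vs i)) -> 0 <= welfare M vs.
Proof. by move=> sm; apply: sumr_ge0 => i _; apply: singleminded_ge0. Qed.

Lemma welfare_ge M vs i : (forall i, singleminded m (vs i)) ->
  vs i (truthful_alloc R n M vs i) <= welfare M vs.
Proof.
move=> sm; rewrite /welfare (bigD1 i) //= lerDl.
by apply: sumr_ge0 => j _; apply: singleminded_ge0.
Qed.

Lemma sum_le_OPT vs (q : {ffun 'I_n -> 'I_m.+1}) :
  (\sum_(i < n) q i <= m)%N -> \sum_(i < n) vs i (q i) <= OPT m vs.
Proof. by move=> qm; apply: (le_bigmax_cond _ _ qm). Qed.

Lemma OPT_attained vs : (forall i, singleminded m (vs i)) ->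
  exists2 q : {ffun 'I_n -> 'I_m.+1}, (\sum_(i < n) q i <= m)%N
    & OPT m vs = \sum_(i < n) vs i (q i).
Proof.
move=> sm; pose q0 : {ffun 'I_n -> 'I_m.+1} := [ffun=> ord0].
have q0m : (\sum_(i < n) q0 i <= m)%N by rewrite big1 // => i _; rewrite ffunE.
rewrite /OPT (bigmax_eq_arg _ _ _ _ q0m) => [|q _]; last first.
  by apply: sumr_ge0 => i _; apply: singleminded_ge0.
by case: arg_maxP => // q qm _; exists q.
Qed.

(** * Linear prices, for valuations that are all small *)

Definition linear_rule r (q : nat) : R := OPT m r / (8 * m%:R) * q%:R.

Lemma welfare_linear vs S (q : {ffun 'I_n -> 'I_m.+1}) :
    (forall i, singleminded m (vs i)) -> (0 < m)%N ->
    (\sum_(i < n) q i <= m)%N -> OPT m vs = \sum_(i < n) vs i (q i) ->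
    (forall i, vs i m <= OPT m vs / 16) -> 0 < OPT m vs ->
  OPT m vs / 64 - (\sum_i vs i (q i) * sgn R 'I_n S i) ^+ 2 / (16 * OPT m vs)
  <= welfare (auction linear_rule S) vs.
Proof.
move=> sm m0 qm OPTq small O0; set O := OPT m vs in small O0 OPTq *.
set W := welfare _ _.
have W0 : 0 <= W := welfare_ge0 _ _ sm.
set YS := \sum_(i in S) vs i (q i).
set YN := \sum_(i in ~: S) vs i (q i).
have OY : O = YS + YN.
  rewrite OPTq (bigID (mem S)) /=; congr (_ + _).
  by apply: eq_bigl => i; rewrite !inE.
have -> : \sum_i vs i (q i) * sgn R 'I_n S i = YS - YN.
  rewrite (bigID (mem S)) /= -sumrN; congr (_ + _).
    by apply: eq_bigr => i iS; rewrite /sgn iS mulr1.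
  apply: eq_big => [i|i iS]; first by rewrite inE.
  by rewrite /sgn (negbTE iS) mulrN1.
have [r rE alloc] := auction_alloc linear_rule S vs.
set F := truthful_alloc _ _ _ _ in alloc.
have WF : W = \sum_i vs i (F i) by [].
set E := OPT m r.
(* The reports are pointwise at most the true valuations, which gives [E <= O]; evaluating the
   optimum [q] at the reports gives [YS <= E]. *)
have EO : E <= O.
  apply: bigmax_le => [|q' q'm]; first exact: ltW.
  apply: le_trans (sum_le_OPT _ _ q'm); apply: ler_sum => i _.
  by rewrite rE; case: ifP => // _; apply: singleminded_ge0.
have YSE : YS <= E.
  apply: le_trans (sum_le_OPT _ _ qm); rewrite /YS big_mkcond.
  by apply: ler_sum => i _; rewrite rE; case: ifP.
have YS0 : 0 <= YS by apply: sumr_ge0 => i _; apply: singleminded_ge0.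
have E0 : 0 <= E := le_trans YS0 YSE.
have mR : 0 < m%:R :> R by rewrite ltr0n.
set p := E / (8 * m%:R).
have p0 : 0 <= p by rewrite divr_ge0 // mulr_ge0 // ltW.
have pm : p * m%:R = E / 8 by rewrite /p; field; rewrite gt_eqF.
(* Buying nothing has utility 0, so each buyer's value covers his payment and welfare is at least
   revenue. *)
have W_sold : p * (\sum_i F i)%:R <= W.
  rewrite WF natr_sum mulr_sumr; apply: ler_sum => i _.
  have [FS FN] := alloc i.
  case: (boolP (i \in S)) => [/FS ->|/FN[k Fk _]].
    by rewrite mulr0 singleminded_ge0.
  have := choice_max R (linear_rule r) (vs i) k 0 isT.
  rewrite -Fk singleminded0 // /linear_rule -/E -/p; lra.
(* If more than half of the items are sold, the revenue is large enough;
   otherwise every buyer could have bought his optimal quantity, except for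
   the at most one bidder whose optimal quantity exceeds m/2. *)
have [sold|unsold] := ltnP m (2 * \sum_i F i).
  have {}W_sold : E / 16 <= W.
    apply: le_trans W_sold; rewrite -(ltr_nat R) natrM in sold.
    have := ler_wpM2l p0 (ltW sold); lra.
  (* If [YS >= O / 4], then [E / 16 >= O / 64]. Otherwise [YN > 3 * O / 4], the two sides differ by
     more than [O / 2], and the claimed bound is at most 0. *)
  have [?|?] := lerP (O / 4) YS.
    have : 0 <= (YS - YN) ^+ 2 / (16 * O).
      by rewrite divr_ge0 ?sqr_ge0 // mulr_ge0 // ltW.
    lra.
  have : O / 64 <= (YS - YN) ^+ 2 / (16 * O).
    by rewrite ler_pdivlMr ?mulr_gt0 //; nra.
  lra.
have W_unsold : YN - E / 8 - O / 16 <= W.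
  pose big i := (m < 2 * q i)%N.
  have YN_le : YN <= \sum_i (vs i (F i) + p * (q i)%:R + (big i)%:R * (O / 16)).
    rewrite /YN big_mkcond; apply: ler_sum => i _; rewrite inE.
    have Fi0 := singleminded_ge0 _ (F i) (sm i).
    have pq0 : 0 <= p * (q i)%:R by rewrite mulr_ge0.
    case: (boolP (i \in S)) => [_|iS] /=.
      by rewrite !addr_ge0 // mulr_ge0 // divr_ge0 // ltW.
    have [_ /(_ iS)[k Fk mk]] := alloc i.
    rewrite /big; case: ltnP => qi; rewrite /= ?mul1r ?mul0r.
      have := le_trans (singleminded_le _ (q i) (sm i)) (small i); lra.
    (* At least half of the items stay unsold, so [i] was offered at least [m / 2] of them. *)
    have qk : (q i <= k)%N.
      have : (\sum_(j | j != i) F j <= \sum_j F j)%N.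
        by rewrite [leqRHS](bigD1 i) //= leq_addl.
      lia.
    have := choice_max R (linear_rule r) (vs i) k (q i) qk.
    rewrite -Fk /linear_rule -/E -/p.
    have : 0 <= p * (F i)%:R by rewrite mulr_ge0.
    lra.
  have pq : p * (\sum_i q i)%:R <= E / 8.
    by rewrite -pm ler_wpM2l // ler_nat.
  have one_big : (\sum_i (big i)%:R : R) <= 1.
    rewrite -natr_sum (_ : 1 = 1%:R) // ler_nat.
    (* The strict [m < 2 * q i] yields the factor [m.+1]; two big bidders would then force
       [m.+1 <= m]. *)
    have big_sum : (m.+1 * \sum_i big i <= 2 * \sum_i q i)%N.
      rewrite !big_distrr /=; apply: leq_sum => i _; rewrite /big.
      by case: ltnP => //; rewrite ?muln1 ?muln0.
    have [//|two_big] := leqP (\sum_i big i)%N 1%N.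
    have := leq_trans (leq_mul (leqnn m.+1) two_big) big_sum.
    move=> /leq_trans/(_ (leq_mul (leqnn 2) qm)).
    by rewrite mulnC leq_pmul2l // ltnn.
  move: YN_le; rewrite !big_split /= -mulr_sumr -mulr_suml -WF -natr_sum.
  have : (\sum_i (big i)%:R) * (O / 16) <= O / 16.
    by rewrite ler_piMl // divr_ge0 ?ltW.
  lra.
(* By [E <= O], the first case leaves [O / 4 - O / 8 - O / 16 = O / 16]; in the second the claimed
   bound is again at most 0. *)
have [?|?] := lerP (O / 4) YN.
  have : 0 <= (YS - YN) ^+ 2 / (16 * O).
    by rewrite divr_ge0 ?sqr_ge0 // mulr_ge0 // ltW.
  lra.
have : O / 64 <= (YS - YN) ^+ 2 / (16 * O).
  by rewrite ler_pdivlMr ?mulr_gt0 //; nra.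
lra.
Qed.

(** Each contribution is at most [O / 16], so the mean of [D S ^+ 2] is at most [O ^+ 2 / 16], and
    [1 / 64 - 1 / 256 = 3 / 256]. *)
Lemma sum_welfare_linear vs : (forall i, singleminded m (vs i)) ->
    (0 < m)%N -> (forall i, vs i m <= OPT m vs / 16) -> 0 < OPT m vs ->
  2 ^+ n * (OPT m vs * 3 / 256)
  <= \sum_S welfare (auction linear_rule S) vs.
Proof.
move=> sm m0 small O0; have [q qm Oq] := OPT_attained _ sm.
pose D S := \sum_i vs i (q i) * sgn R 'I_n S i.
apply: (@le_trans _ _
  (\sum_S (OPT m vs / 64 - D S ^+ 2 / (16 * OPT m vs)))); last first.
  by apply: ler_sum => S _; apply: welfare_linear.
rewrite sumrB -[X in _ - X]mulr_suml sum_sqr_sgn !sum_const_sets card_ord.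
set O := OPT m vs in small O0 Oq *.
have sq : \sum_i vs i (q i) ^+ 2 <= O / 16 * O.
  rewrite [X in _ <= _ * X]Oq mulr_sumr; apply: ler_sum => i _.
  rewrite expr2 ler_wpM2r ?singleminded_ge0 //.
  exact: le_trans (singleminded_le _ _ (sm i)) (small i).
have : (\sum_i vs i (q i) ^+ 2) / (16 * O) <= O / 256.
  rewrite ler_pdivrMr ?mulr_gt0 //; apply: le_trans sq _.
  by rewrite le_eqVlt; apply/orP; left; apply/eqP; field.
have P0 : 0 < 2 ^+ n :> R by rewrite exprn_gt0.
move=> /(ler_wpM2l (ltW P0)); rewrite mulrA; lra.
Qed.

(** * Flat fees, aimed at the highest values *)

Definition flat_rule (lam : R) r (q : nat) : R :=
  lam * \big[Num.max/0]_(i < n) r i m * (0 < q)%:R.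

(** Here [c] is the maximal report; the alternative [c = 0] covers an empty sample, where the big
    maximum takes its default. Someone buys, since otherwise [a] would face the full supply and
    gain. A buyer's utility is strictly positive, so he obtains his full value, which exceeds the
    fee. *)
Lemma welfare_flat lam vs S a c : (forall i, singleminded m (vs i)) ->
    0 <= lam -> 0 <= c -> lam * c < vs a m -> a \notin S ->
    (forall i, i \in S -> vs i m <= c) ->
    c = 0 \/ (exists2 b, b \in S & vs b m = c) ->
  exists2 i, lam * c < vs i m
           & vs i m <= welfare (auction (flat_rule lam) S) vs.
Proof.
move=> sm lam0 c0 ac aS Sc c_attained.
have [r rE alloc] := auction_alloc (flat_rule lam) S vs.
set F := truthful_alloc _ _ _ _ in alloc.
have price q : flat_rule lam r q = lam * c * (0 < q)%:R.
  rewrite /flat_rule; congr (_ * _ * _); apply: le_anti; apply/andP; split.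
    by apply: bigmax_le => // i _; rewrite rE; case: ifP => // /Sc.
  case: c_attained => [->|[b bS <-]]; first exact: bigmax_ge_id.
  by apply: (bigmax_sup b); rewrite ?rE ?bS.
have [i Fi] : exists i, (0 < F i)%N.
  apply/existsP; rewrite -[X in is_true X]negbK; apply/negP => /existsPn F0.
  have [_ /(_ aS)[k Fk]] := alloc a.
  rewrite big1 ?addn0 => [mk|j _]; last by have := F0 j; case: (F j).
  have := choice_max R (flat_rule lam r) (vs a) k m mk.
  have := F0 a; rewrite -Fk lt0n negbK => /eqP ->.
  rewrite !price (singleminded_supply_gt0 _ (sm a)) singleminded0 //=; lra.
have iS : i \notin S.
  by apply: contraL Fi => iS; have [/(_ iS) ->] := alloc i.
have [_ /(_ iS)[k Fk _]] := alloc i.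
have := Fi; rewrite Fk => /choice_gt; rewrite -Fk !price Fi singleminded0 //=.
rewrite mulr0 subr0 mulr1 subr_gt0 => vFi.
have vFm : vs i (F i) = vs i m.
  by apply: singleminded_pos => //; apply: le_lt_trans vFi; apply: mulr_ge0.
exists i; first by rewrite -vFm.
by rewrite -vFm; apply: welfare_ge.
Qed.

(** The weights balance the two main cases: [1 / 4 * (1 / 4)] without a tie at the top and
    [1 / 2 * (1 / 8)] with one are both [1 / 16]. *)
Lemma sum_welfare_flat vs a : (forall i, singleminded m (vs i)) ->
    0 < vs a m -> (forall i, vs i m <= vs a m) ->
  2 ^+ n * (vs a m / 16)
  <= 1 / 4 * (\sum_S welfare (auction (flat_rule 1) S) vs)
     + 1 / 2 * (\sum_S welfare (auction (flat_rule (1 / 2)) S) vs).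
Proof.
move=> sm a0 a_max.
have W0 lam S : 0 <= welfare (auction (flat_rule lam) S) vs.
  exact: welfare_ge0.
have SW0 lam : 0 <= \sum_S welfare (auction (flat_rule lam) S) vs.
  by apply: sumr_ge0.
have P0 : 0 < 2 ^+ n :> R by rewrite exprn_gt0.
have Pa0 : 0 < 2 ^+ n * vs a m by rewrite mulr_gt0.
(* If [a] is the only bidder, there is no runner-up: a sample avoiding [a] is empty and the fee is
   0. *)
case: (pickP (fun b => b != a)) => [b0 b0a|only_a]; last first.
  have : 2 ^+ #|'I_n| * (vs a m / 2)
      <= \sum_S welfare (auction (flat_rule 1) S) vs.
    apply: (sum_set1_ge _ _ _ a) => // S aS.
    have price i : i \in S -> vs i m <= 0.
      by have /negbFE/eqP -> := only_a i; rewrite (negbTE aS).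
    have lt0 : 1 * 0 < vs a m by rewrite mulr0.
    have [i _] := welfare_flat 1 vs S a 0 sm ler01 (lexx 0) lt0 aS price
      (or_introl erefl).
    by have /negbFE/eqP -> := only_a i.
  by rewrite card_ord; have := SW0 (1 / 2); lra.
have [b ba b_max] : exists2 b, b != a & forall i, i != a -> vs i m <= vs b m.
  exists [arg max_(b > b0 | b != a) vs b m]%O; case: arg_maxP => //.
have b_ge0 : 0 <= vs b m := singleminded_ge0 _ m (sm b).
have price S : a \notin S -> forall i, i \in S -> vs i m <= vs b m.
  by move=> aS i iS; apply: b_max; apply: contraNneq aS => <-.
have [b_lt|b_ge] := ltP (vs b m) (vs a m).
  have : 2 ^+ #|'I_n| * (vs a m / 4)
      <= \sum_S welfare (auction (flat_rule 1) S) vs.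
    apply: (sum_set2_ge _ _ _ a b) => // [|S aS bS]; first by rewrite eq_sym.
    have lt_a : 1 * vs b m < vs a m by rewrite mul1r.
    have [i] := welfare_flat 1 vs S a _ sm ler01 b_ge0 lt_a aS (price S aS)
      (or_intror (ex_intro2 _ _ b bS erefl)).
    rewrite mul1r => bi; suff -> : i = a by [].
    by apply/eqP; apply: contraTT bi => /b_max; rewrite -leNgt.
  by rewrite card_ord; have := SW0 (1 / 2); lra.
have : 2 ^+ #|'I_n| * (vs a m / 2 / 4)
    <= \sum_S welfare (auction (flat_rule (1 / 2)) S) vs.
  apply: (sum_set2_ge _ _ _ a b) => // [|S aS bS]; first by rewrite eq_sym.
  have lt_a : 1 / 2 * vs b m < vs a m by have := a_max b; lra.
  have half_ge0 : 0 <= 1 / 2 :> R by lra.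
  have [i] := welfare_flat (1 / 2) vs S a _ sm half_ge0 b_ge0 lt_a aS
    (price S aS) (or_intror (ex_intro2 _ _ b bS erefl)).
  lra.
by rewrite card_ord; have := SW0 1; lra.
Qed.

End Auction.

(** Stated with [List.In] because mechanisms carry no decidable equality. The element [x] is kept so
    that weights and prices can be checked rule by rule. *)
Lemma In_allpairs {A B C : Type} {f : A -> B -> C} {s t e} :
  List.In e [seq f x y | x <- s, y <- t] ->
  exists x y, List.In x s /\ e = f x y.
Proof.
have In_cat (u w : seq C) : List.In e (u ++ w) -> List.In e u \/ List.In e w.
  by elim: u => [|c u IHu] /=; [right | case=> [->|/IHu[]]; auto].
have In_map x (u : seq B) : List.In e (map (f x) u) -> exists y, e = f x y.
  by elim: u => //= y u IHu [<-|/IHu //]; exists y.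
elim: s => //= x s IHs /In_cat[/In_map[y ->]|/IHs[x' [y [x's ->]]]].
  by exists x, y; auto.
by exists x', y; auto.
Qed.

(** * The lottery over samples and pricing rules *)

Section Mixture.
Variables (R : realType) (n m : nat).

Definition mixture_rules : seq (R * (('I_n -> nat -> R) -> nat -> R)) :=
  [:: (1 / 4, linear_rule R n m); (1 / 4, flat_rule R n m 1);
      (1 / 2, flat_rule R n m (1 / 2))].

Definition mixture : seq (R * mech_strat R n) :=
  [seq (e.1 / 2 ^+ n, auction R n m e.2 A)
     | e <- mixture_rules, A <- enum {: {set 'I_n}}].

Lemma mixture_sum (F : mech_strat R n -> R) :
  \sum_(e <- mixture) e.1 * F e.2 =
  \sum_(e <- mixture_rules)
     e.1 / 2 ^+ n * \sum_(S : {set 'I_n}) F (auction R n m e.2 S).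
Proof.
rewrite big_allpairs_dep; apply: eq_bigr => e _.
by rewrite mulr_sumr big_enum.
Qed.

Lemma mixture_distribution : distribution mixture.
Proof.
have P0 : 0 < 2 ^+ n :> R by rewrite exprn_gt0.
split=> [e /In_allpairs[x [S [xs ->]]] /=|].
  apply: divr_ge0 (ltW P0).
  by case: xs => [<-|[<-|[<-|[]]]] /=; lra.
have := mixture_sum (fun=> 1); under eq_bigr do rewrite mulr1.
move=> ->.
under eq_bigr do rewrite sum_const_sets card_ord mulr1 divfK ?gt_eqF //.
by rewrite /mixture_rules !big_cons big_nil /=; lra.
Qed.

Lemma mixture_OSP : universally_OSP m mixture.
Proof.
move=> e /In_allpairs[x [S [xs ->]]] _ /=.
split; first exact: feasible_auction.
apply: OSP_auction => r.
by case: xs => [<-|[<-|[<-|[]]]] /=; rewrite /linear_rule /flat_rule mulr0.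
Qed.

(** The linear rule has weight [1 / 4] and yields the fraction [3 / 1024] of the optimum; the flat
    fees yield [1 / 16 * (1 / 16) = 1 / 256]. Both exceed [1 / 400]. *)
Lemma mixture_approx : approx m 400 mixture.
Proof.
move=> vs sm.
have P0 : 0 < 2 ^+ n :> R by rewrite exprn_gt0.
rewrite /exp_welfare (mixture_sum (fun M => welfare M vs)).
rewrite /mixture_rules !big_cons big_nil /=.
set L := \sum_S _; set F1 := \sum_S _; set F2 := \sum_S _.
have L0 : 0 <= L by apply: sumr_ge0 => S _; apply: welfare_ge0.
have F10 : 0 <= F1 by apply: sumr_ge0 => S _; apply: welfare_ge0.
have F20 : 0 <= F2 by apply: sumr_ge0 => S _; apply: welfare_ge0.
suff : 2 ^+ n * (OPT m vs / 400) <= 1 / 4 * L + 1 / 4 * F1 + 1 / 2 * F2.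
  rewrite mulrC -ler_pdivlMr // => /(ler_wpM2l (ler0n R 400)).
  rewrite mulrCA divff ?pnatr_eq0 // mulr1 => /le_trans; apply.
  by rewrite le_eqVlt; apply/orP; left; apply/eqP; field; rewrite gt_eqF.
have [O0|O0] := lerP (OPT m vs) 0.
  have : 2 ^+ n * (OPT m vs / 400) <= 0.
    by apply: mulr_ge0_le0; [exact: ltW | lra].
  lra.
(* A positive optimum is not an empty sum, so there is a bidder from whom to start the argmax. *)
have [i0 _] : exists i : 'I_n, true.
  have [q _ E] := OPT_attained _ _ _ _ sm; apply/existsP; apply: contraT.
  move=> /existsPn no_bidder.
  by move: O0; rewrite E big1 ?ltxx // => i; have := no_bidder i.
have [a _ a_max] : exists2 a, true & forall i, vs i m <= vs a m.
  exists [arg max_(a > i0) vs a m]%O => // i.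
  by case: arg_maxP => // a _; apply.
have PO0 : 0 < 2 ^+ n * OPT m vs by rewrite mulr_gt0.
have [small|large] := lerP (vs a m) (OPT m vs / 16).
  have := sum_welfare_linear _ _ _ vs sm (singleminded_supply_gt0 _ _ _ (sm a))
    (fun i => le_trans (a_max i) small) O0.
  rewrite -/L; lra.
have a0 : 0 < vs a m by lra.
have := sum_welfare_flat _ _ _ vs a sm a0 a_max.
have := ltW large; rewrite -(ler_pM2l P0) -/F1 -/F2; lra.
Qed.

End Mixture.

Theorem theorem3p2 (R : realType) (n m : nat) :
  exists D : seq (R * mech_strat R n),
    distribution D /\ universally_OSP m D /\ approx m 400 D.
Proof.
exists (mixture R n m); split; first exact: mixture_distribution.
by split; [exact: mixture_OSP | exact: mixture_approx].
Qed.
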